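(* Let $\{f_l:\mathbb{R}^{p_l}\times\mathbb{R}^{d_{l-1}\times N}\to\mathbb{R}^{d_l\times N}\}_{l=1}^L$ be continuously differentiable maps, let $X\in\mathbb{R}^{d_0\times N}$ be a data matrix, and let $F$ be the associated parameter-function map. Then for every $\vec\theta=(\theta_1,\dots,\theta_L)\in\mathbb{R}^{\sum_lp_l}$, $$\lambda\big(DF(\vec\theta)\big)\;\geq\;\sum_{l=1}^{L}\lambda\big(Df_l(\theta_l,f_{<l}(\vec\theta,X))\big)\prod_{j=l+1}^{L}\lambda\big(Jf_j(\theta_j,f_{<j}(\vec\theta,X))\big).$$
   Context: $Df_l$ and $Jf_l$ denote the derivatives of $f_l$ with respect to the parameter variable in $\mathbb{R}^{p_l}$ and the input variable in $\mathbb{R}^{d_{l-1}\times N}$ respectively, regarded as matrices after vectorising (of sizes $d_lN\times p_l$ and $d_lN\times d_{l-1}N$). For a real matrix $A$, $\lambda(A)$ denotes the smallest eigenvalue of $AA^T$. With $f_l(\theta_l)$ denoting the map $Z\mapsto f_l(\theta_l,Z)$, put $f_{<l}(\vec\theta,X):=f_{l-1}(\theta_{l-1})\circ\cdots\circ f_1(\theta_1)(X)$ (so $f_{<1}(\vec\theta,X)=X$). The parameter-function map is $F(\vec\theta)=f_L(\theta_L)\circ\cdots\circ f_1(\theta_1)(X)\in\mathbb{R}^{d_L\times N}$. Empty products equal $1$. *)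

(* Defs.v *)
From HB Require Import structures.
From mathcomp Require Import all_boot all_order all_algebra.
From mathcomp Require Import all_classical all_reals all_analysis.

Set Implicit Arguments.
Unset Strict Implicit.
Unset Printing Implicit Defensive.

Import Order.TTheory GRing.Theory Num.Theory.
Import numFieldNormedType.Exports.

Local Open Scope classical_set_scope.
Local Open Scope ring_scope.

(* The set of eigenvalues is finite, and nonempty when 0 < m, so that the
   infimum is a minimum. For the empty matrix (m = 0) the value is 0. *)
Definition lambda (R : realType) (m n : nat) (A : 'M[R]_(m, n)) : R :=
  inf [set a : R | eigenvalue (A *m A^T) a].

(* Fréchet differentiable everywhere, with a derivative that is continuous for
   the operator norm on linear maps. *)
Definition continuously_differentiable (R : realType) (U V : normedModType R)
    (g : U -> V) : Prop :=
  (forall x, differentiable g x) /\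
  (forall (x : U) (e : R), 0 < e ->
     \forall y \near x, forall v : U, `|'d g y v - 'd g x v| <= e * `|v|).

(* MathComp's Jacobian acts on row vectors from the right (its entry (i, j) is
   the i-th partial derivative of the j-th component), hence the transpose. *)
Definition Jacobian_matrix (R : realType) (n m : nat)
    (g : 'rV[R]_n -> 'rV[R]_m) (x : 'rV[R]_n) : 'M[R]_(m, n) :=
  ('J g x)^T.

Definition Dparam (R : realType) (p m N : nat)
    (g : 'rV[R]_p -> 'M[R]_(m, N)) (theta : 'rV[R]_p) : 'M[R]_(m * N, p) :=
  Jacobian_matrix (fun t => mxvec (g t)) theta.

Definition Jinput (R : realType) (n m N : nat)
    (g : 'M[R]_(n, N) -> 'M[R]_(m, N)) (Z : 'M[R]_(n, N)) :
    'M[R]_(m * N, n * N) :=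
  Jacobian_matrix (fun z => mxvec (g (vec_mx z))) (mxvec Z).

(* Layers are numbered from 0: [f l] is the map usually called f_{l+1}. *)
Section ParameterFunctionMap.
Context {R : realType} {L N : nat} {p : 'I_L -> nat} {d : nat -> nat}.
Variable f :
  forall l : 'I_L, 'rV[R]_(p l) -> 'M[R]_(d l, N) -> 'M[R]_(d l.+1, N).
Variable X : 'M[R]_(d 0%N, N).
Variable theta : 'rV[R]_(\sum_(l < L) p l).

Definition param (l : 'I_L) : 'rV[R]_(p l) := submxrow theta l.

Fixpoint compose_first (n : nat) : (n <= L)%N -> 'M[R]_(d n, N) :=
  match n with
  | 0 => fun _ => X
  | k.+1 => fun k_lt_L : (k < L)%N =>
      f (param (Ordinal k_lt_L)) (compose_first (ltnW k_lt_L))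
  end.

Definition f_below (l : 'I_L) : 'M[R]_(d l, N) :=
  compose_first (ltnW (ltn_ord l)).

Definition param_fun : 'M[R]_(d L, N) := compose_first (leqnn L).

End ParameterFunctionMap.

(* Main.v *)
(** When [A] has a row, [lambda A] is the best constant [c] in
    [c |u|^2 <= |u A|^2]: the minimum of this quadratic form on the unit sphere
    is an eigenvalue of [A A^T].  Write [F_n] for the composition of the first
    [n] layers.  By the chain rule [D F_(n+1) = Df_n S_n + Jf_n (D F_n)], where
    [S_n] selects the coordinates of the [n]-th parameter.  Since [F_n] does not
    depend on that parameter, the two summands have orthogonal rows, so
    [lambda (D F_(n+1)) >= lambda (Df_n) + lambda (Jf_n) * lambda (D F_n)], and
    iterating this inequality gives the sum. *)

Require Import Defs.
From HB Require Import structures.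
From mathcomp Require Import all_boot all_order all_algebra.
From mathcomp Require Import all_classical all_reals all_analysis.
From mathcomp Require Import ring.

Set Implicit Arguments.
Unset Strict Implicit.
Unset Printing Implicit Defensive.

Import Order.TTheory GRing.Theory Num.Theory.
Import numFieldNormedType.Exports.

Local Open Scope classical_set_scope.
Local Open Scope ring_scope.

(** * Euclidean norm of row vectors *)

(** The norm that real matrices carry is the largest absolute value of an entry, so the Euclidean
    one is introduced separately. *)
Definition sqnorm (R : pzRingType) (n : nat) (u : 'rV[R]_n) : R :=
  (u *m u^T) 0 0.

Lemma sqnormE (R : pzRingType) n (u : 'rV[R]_n) :
  sqnorm u = \sum_i u 0 i * u 0 i.
Proof. by rewrite /sqnorm mxE; apply: eq_bigr => i _; rewrite mxE. Qed.

Lemma sqnormZ (R : comPzRingType) n (a : R) (u : 'rV[R]_n) :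
  sqnorm (a *: u) = a ^+ 2 * sqnorm u.
Proof. by rewrite /sqnorm linearZ /= -scalemxAl -scalemxAr scalerA mxE. Qed.

Lemma sqnorm_ge0 (R : realDomainType) n (u : 'rV[R]_n) : 0 <= sqnorm u.
Proof. by rewrite sqnormE sumr_ge0 // => i _; rewrite -expr2 sqr_ge0. Qed.

Lemma sqnorm_eq0 (R : realDomainType) n (u : 'rV[R]_n) :
  (sqnorm u == 0) = (u == 0).
Proof.
apply/eqP/eqP => [|->]; last by rewrite /sqnorm mul0mx mxE.
rewrite sqnormE => /eqP; rewrite psumr_eq0; last first.
  by move=> i _; rewrite -expr2 sqr_ge0.
move=> /allP u0; apply/rowP => i; rewrite mxE.
have := u0 i; rewrite mem_index_enum => /(_ isT) /=.
by rewrite mulf_eq0 orbb => /eqP.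
Qed.

(** * Smallest eigenvalue of a symmetric matrix *)

Lemma linear_mx_continuous (R : realType) m n k l
    (g : {linear 'M[R]_(m, n) -> 'M[R]_(k, l)}) : continuous g.
Proof.
apply: bounded_linear_continuous; apply/bounded_funP => r.
(* [A] expands in the matrices [delta_mx i j] with coefficients of absolute value at most [r]. *)
exists (\sum_i \sum_j r * `|g (delta_mx i j)|) => A Ar.
rewrite {1}[A]matrix_sum_delta !linear_sum.
apply: (le_trans (ler_norm_sum _ _ _)); apply: ler_sum => i _.
rewrite !linear_sum.
apply: (le_trans (ler_norm_sum _ _ _)); apply: ler_sum => j _.
rewrite linearZ /= normrZ ler_wpM2r //; apply: le_trans Ar.
rewrite [leRHS]/Num.norm /= mx_normrE.
exact: (@le_bigmax _ _ _ 0 (fun ij : 'I_m * 'I_n => `|A ij.1 ij.2|) (i, j)).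
Qed.

Lemma quadratic_form_continuous (R : realType) n (S : 'M[R]_n) :
  continuous (fun u : 'rV[R]_n => (u *m S *m u^T) 0 0).
Proof.
have -> : (fun u : 'rV[R]_n => (u *m S *m u^T) 0 0) =
    (fun u => \sum_j (u *m S) 0 j * u 0 j).
  by apply: funext => u; rewrite [LHS]mxE; apply: eq_bigr => j _;
     rewrite [u^T _ _]mxE.
apply: continuous_big => [|j _ u]; first exact: add_continuous.
have cS : continuous (mulmxr S : 'rV[R]_n -> 'rV[R]_n).
  exact: linear_mx_continuous.
have cj (v : 'rV[R]_n) : {for v, continuous (fun w : 'rV[R]_n => w 0 j)}.
  exact: coord_continuous.
exact: (continuousM (continuous_comp (cS u) (cj _)) (cj u)).
Qed.

Lemma sphere_compact (R : realType) n :
  compact [set u : 'rV[R]_n | sqnorm u = 1].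
Proof.
apply: bounded_closed_compact.
  exists 1; split => // M M1 u /= u1; apply: le_trans (ltW M1).
  rewrite [leLHS]/Num.norm /= mx_normrE.
  apply/bigmax_leP; split => // -[i j] _ /=.
  rewrite ord1 -(expr_le1 (ltn0Sn 1)) // real_normK ?num_real // -u1 sqnormE.
  rewrite (bigD1 j) //= expr2 lerDl sumr_ge0 // => k _.
  by rewrite -expr2 sqr_ge0.
have -> : [set u : 'rV[R]_n | sqnorm u = 1] =
    (fun u : 'rV[R]_n => (u *m 1%:M *m u^T) 0 0) @^-1` [set x | x = 1].
  by apply: funext => u /=; rewrite mulmx1.
apply: preimage_closed; first by move=> u _; exact: quadratic_form_continuous.
exact: closed_eq.
Qed.

(* As a function of [t], the form at [u + t u S] is nonnegative and vanishes at
   [0], and its linear coefficient is twice the squared norm of [u S]. *)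
Lemma psd_isotropic_ker (R : realFieldType) n (S : 'M[R]_n) (u : 'rV[R]_n) :
  S^T = S -> (forall v : 'rV[R]_n, 0 <= (v *m S *m v^T) 0 0) ->
  (u *m S *m u^T) 0 0 = 0 -> u *m S = 0.
Proof.
move=> symS psdS u0; set w := u *m S; set k : R := (w *m S *m w^T) 0 0.
have wu : (w *m S *m u^T) 0 0 = sqnorm w.
  by rewrite /sqnorm [in RHS]/w trmx_mul symS mulmxA.
have expand t : ((u + t *: w) *m S *m (u + t *: w)^T) 0 0 =
    2 * t * sqnorm w + t ^+ 2 * k.
  rewrite linearD linearZ /= !mulmxDl !mulmxDr -!scalemxAl -!scalemxAr -/w.
  rewrite ![fun_of_matrix (_ + _) _ _]mxE ![fun_of_matrix (_ *: _) _ _]mxE.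
  rewrite wu -/k -/(sqnorm w) u0.
  ring.
apply/eqP; rewrite -sqnorm_eq0 eq_le sqnorm_ge0 andbT leNgt.
apply/negP => w_gt0.
have k_ge0 : 0 <= k by exact: psdS.
have k1_gt0 : 0 < k + 1 by rewrite ltr_wpDl.
(* The minimiser [- (sqnorm w / k)] would fail at [k = 0]; with [k + 1] the value is still
   negative. *)
have := psdS (u + (- (sqnorm w / (k + 1))) *: w).
rewrite expand sqrrN expr_div_n.
have -> : 2 * - (sqnorm w / (k + 1)) * sqnorm w +
    sqnorm w ^+ 2 / (k + 1) ^+ 2 * k =
    - (sqnorm w ^+ 2 * (k + 2) / (k + 1) ^+ 2).
  by field; rewrite gt_eqF.
rewrite oppr_ge0 leNgt divr_gt0 ?exprn_gt0 //.
by rewrite mulr_gt0 ?exprn_gt0 // ltr_wpDl.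
Qed.

(** At a minimiser [c] of the form [q] on the unit sphere, [S - (q c)%:M] is positive semidefinite
    and its form vanishes at [c], so [c] is in its kernel. *)
Lemma min_eigenvalue_symmetric (R : realType) n (S : 'M[R]_n) :
  (0 < n)%N -> S^T = S ->
  exists2 mu, eigenvalue S mu &
    forall u : 'rV[R]_n, mu * sqnorm u <= (u *m S *m u^T) 0 0.
Proof.
move=> n_gt0 symS; set q := fun u : 'rV[R]_n => (u *m S *m u^T) 0 0.
have sphere0 : [set u : 'rV[R]_n | sqnorm u = 1] !=set0.
  exists (delta_mx 0 (Ordinal n_gt0)) => /=.
  by rewrite /sqnorm trmx_delta mul_delta_mx mxE !eqxx.
have [c c1 cmin] := EVT_min_rV sphere0 (@sphere_compact R n)
  (continuous_subspaceT (@quadratic_form_continuous R n S)).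
have {}c1 : sqnorm c = 1 by move: c1; rewrite inE.
have minq u : q c * sqnorm u <= q u.
  have [->|u0] := eqVneq u 0.
    by rewrite /q /sqnorm !mul0mx [fun_of_matrix 0 _ _]mxE mulr0.
  have u_gt0 : 0 < sqnorm u by rewrite lt_def sqnorm_eq0 u0 sqnorm_ge0.
  (* By homogeneity, minimality on the sphere extends to every nonzero [u]. *)
  have := cmin ((Num.sqrt (sqnorm u))^-1 *: u).
  rewrite inE /= sqnormZ exprVn sqr_sqrtr ?sqnorm_ge0 // mulVf ?gt_eqF //.
  move=> /(_ erefl); rewrite linearZ /= -!scalemxAl -scalemxAr scalerA.
  rewrite -expr2 exprVn sqr_sqrtr ?sqnorm_ge0 // [leRHS]mxE.
  by rewrite ler_pdivlMl // mulrC.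
exists (q c); last exact: minq.
have shiftE u : (u *m (S - (q c)%:M) *m u^T) 0 0 = q u - q c * sqnorm u.
  rewrite mulmxBr mulmxBl mul_mx_scalar -scalemxAl.
  by rewrite [LHS]mxE [X in _ + X]mxE [X in - X]mxE.
apply/eigenvalueP; exists c; last by rewrite -sqnorm_eq0 c1 oner_eq0.
apply/eqP; rewrite -subr_eq0 -mul_mx_scalar -mulmxBr; apply/eqP.
apply: psd_isotropic_ker => [|u|].
- by rewrite linearB /= symS tr_scalar_mx.
- by rewrite shiftE subr_ge0.
- by rewrite shiftE c1 mulr1 subrr.
Qed.

(** * [lambda] as the best constant *)

Lemma sqnorm_mulmx (R : comPzRingType) m n (u : 'rV[R]_m) (A : 'M[R]_(m, n)) :
  sqnorm (u *m A) = (u *m (A *m A^T) *m u^T) 0 0.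
Proof. by rewrite /sqnorm trmx_mul !mulmxA. Qed.

Lemma eigenvalue_gram_sqnorm (R : realType) m n (A : 'M[R]_(m, n)) a :
  eigenvalue (A *m A^T) a ->
  exists2 u : 'rV[R]_m, u != 0 & sqnorm (u *m A) = a * sqnorm u.
Proof.
move=> /eigenvalueP[u uA u0]; exists u => //.
by rewrite sqnorm_mulmx uA -scalemxAl mxE.
Qed.

(** A lower bound of a set is below its infimum once the set is nonempty; [0 < m] provides an
    eigenvalue. *)
Lemma lambda_ge (R : realType) m n (A : 'M[R]_(m, n)) (c : R) :
  (0 < m)%N -> (forall u : 'rV[R]_m, c * sqnorm u <= sqnorm (u *m A)) ->
  c <= lambda A.
Proof.
move=> m_gt0 cA; apply: lb_le_inf.
  have [|a ? _] := @min_eigenvalue_symmetric R m (A *m A^T) m_gt0.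
    by rewrite trmx_mul trmxK.
  by exists a.
move=> a /= /eigenvalue_gram_sqnorm[u u0 uA]; have := cA u.
by rewrite uA ler_pM2r // lt_def sqnorm_eq0 u0 sqnorm_ge0.
Qed.

Lemma lambda_sqnorm_le (R : realType) m n (A : 'M[R]_(m, n)) (u : 'rV[R]_m) :
  lambda A * sqnorm u <= sqnorm (u *m A).
Proof.
have [m0|m_gt0] := posnP m.
  by subst m; rewrite [u]thinmx0 mul0mx /sqnorm !mul0mx !mxE mulr0.
have symG : (A *m A^T)^T = A *m A^T by rewrite trmx_mul trmxK.
have [mu muG minmu] := min_eigenvalue_symmetric m_gt0 symG.
rewrite sqnorm_mulmx; apply: le_trans (minmu u).
apply: ler_wpM2r; first exact: sqnorm_ge0.
(* The infimum is below [mu] because Gram eigenvalues are bounded below by [0]. *)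
apply: ge_inf => //; exists 0 => a /= /eigenvalue_gram_sqnorm[v v0 vA].
have v_gt0 : 0 < sqnorm v by rewrite lt_def sqnorm_eq0 v0 sqnorm_ge0.
by rewrite -(pmulr_lge0 _ v_gt0) -vA sqnorm_ge0.
Qed.

Lemma lambda_empty (R : realType) n (A : 'M[R]_(0, n)) : lambda A = 0.
Proof.
(* Dimension 0 has no nonzero vector, hence no eigenvalue, and [inf] of the empty set is [0]. *)
rewrite /lambda (_ : [set _ | _] = set0) ?inf0 // -subset0 => a /=.
by move=> /eigenvalueP[u _]; rewrite [u]thinmx0 eqxx.
Qed.

Lemma lambda_ge0 (R : realType) m n (A : 'M[R]_(m, n)) : 0 <= lambda A.
Proof.
have [m0|m_gt0] := posnP m; first by subst m; rewrite lambda_empty.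
by apply: lambda_ge => // u; rewrite mul0r sqnorm_ge0.
Qed.

(* The rows of [A *m S] and those of [B] are orthogonal, so the Gram matrix of
   the sum is that of [A] plus that of [J *m B]. *)
Lemma lambda_layer (R : realType) m n k p (A : 'M[R]_(m, p)) (S : 'M[R]_(p, n))
    (J : 'M[R]_(m, k)) (B : 'M[R]_(k, n)) :
  S *m S^T = 1%:M -> B *m S^T = 0 ->
  lambda A + lambda J * lambda B <= lambda (A *m S + J *m B).
Proof.
move=> SS BS; have [m0|m_gt0] := posnP m.
  by subst m; rewrite !lambda_empty mul0r addr0.
have SB : S *m B^T = 0 by rewrite -[S]trmxK -trmx_mul BS trmx0.
apply: lambda_ge => // u.
have -> : sqnorm (u *m (A *m S + J *m B)) =
    sqnorm (u *m A) + sqnorm (u *m J *m B).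
  rewrite /sqnorm mulmxDr !mulmxA linearD /= mulmxDl !mulmxDr !trmx_mul.
  rewrite !mulmxA -(mulmxA _ S S^T) SS mulmx1.
  rewrite -[_ *m S *m B^T]mulmxA SB mulmx0 !mul0mx addr0.
  by rewrite -[_ *m B *m S^T]mulmxA BS mulmx0 !mul0mx add0r mxE.
rewrite mulrDl lerD ?lambda_sqnorm_le //.
(* The bound for [B] is applied at [u *m J]; the bound for [J] at [u] is then multiplied by
   [lambda B], which is nonnegative. *)
apply: le_trans (lambda_sqnorm_le B _); rewrite mulrAC mulrC.
by rewrite ler_wpM2l ?lambda_ge0 ?lambda_sqnorm_le.
Qed.

(** * Partial derivatives and the chain rule *)

(** Each partial map is [g] after an inclusion [t |-> (t, y)] or [z |-> (x, z)], with differential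
    [a |-> (a, 0)] or [b |-> (0, b)]. *)
Lemma diff_partial (R : realType) (U V W : normedModType R) (g : U * V -> W)
    (x : U) (y : V) :
  differentiable g (x, y) ->
  [/\ differentiable (fun t => g (t, y)) x, differentiable (fun z => g (x, z)) y
    & forall a b, 'd g (x, y) (a, b) =
        'd (fun t => g (t, y)) x a + 'd (fun z => g (x, z)) y b].
Proof.
move=> dg.
have dx : differentiable (fun t : U => (t, y)) x by exact: differentiable_pair.
have dy : differentiable (fun z : V => (x, z)) y by exact: differentiable_pair.
split=> [||a b].
- exact: (differentiable_comp dx dg).
- exact: (differentiable_comp dy dg).
rewrite (diff_comp dx dg) (diff_comp dy dg) /= !diff_pair // !diff_val /=.
by rewrite -linearD /= -[(a, 0) + (0, b)]/(a + 0, 0 + b) addr0 add0r.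
Qed.

Lemma Dparam_mul (R : realType) s m N (g : 'rV[R]_s -> 'M[R]_(m, N))
    (t v : 'rV[R]_s) :
  differentiable g t -> v *m (Dparam g t)^T = mxvec ('d g t v).
Proof.
move=> dg; rewrite /Dparam /Jacobian_matrix trmxK mul_rV_lin1.
have cvec : continuous (mxvec : 'M[R]_(m, N) -> 'rV[R]_(m * N)).
  exact: linear_mx_continuous.
by rewrite (diff_comp dg (linear_differentiable _ cvec)) /= diff_lin.
Qed.

Lemma Jinput_mul (R : realType) n m N (g : 'M[R]_(n, N) -> 'M[R]_(m, N))
    (Z V : 'M[R]_(n, N)) :
  differentiable g Z -> mxvec V *m (Jinput g Z)^T = mxvec ('d g Z V).
Proof.
move=> dg; have cvec : continuous (vec_mx : 'rV[R]_(n * N) -> 'M[R]_(n, N)).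
  exact: linear_mx_continuous.
have dvec := linear_differentiable (mxvec Z) cvec.
have dg' : differentiable g (vec_mx (mxvec Z)) by rewrite mxvecK.
(* [Jinput] unfolds to [Dparam] of the map precomposed with [vec_mx]. *)
rewrite -[Jinput g Z]/(Dparam (g \o vec_mx) (mxvec Z)).
rewrite Dparam_mul; last exact: (differentiable_comp dvec dg').
by rewrite (diff_comp dvec dg') /= diff_lin //= !mxvecK.
Qed.

(** In the application, [P] extracts the parameter of one layer and [h] is the output of the layers
    below, so [t] acts both directly and through [h]. *)
Lemma Dparam_chain (R : realType) s q n m N
    (g : 'rV[R]_q -> 'M[R]_(n, N) -> 'M[R]_(m, N)) (P : 'M[R]_(s, q))
    (h : 'rV[R]_s -> 'M[R]_(n, N)) (t : 'rV[R]_s) :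
  differentiable (fun x : 'rV[R]_q * 'M[R]_(n, N) => g x.1 x.2)
    (t *m P, h t) ->
  differentiable h t ->
  differentiable (fun r => g (r *m P) (h r)) t /\
  Dparam (fun r => g (r *m P) (h r)) t =
    Dparam (fun r => g r (h t)) (t *m P) *m P^T +
    Jinput (g (t *m P)) (h t) *m Dparam h t.
Proof.
move=> dg dh; have [dg1 dg2 dg12] := diff_partial dg.
have cP : continuous (mulmxr P : 'rV[R]_s -> 'rV[R]_q).
  exact: linear_mx_continuous.
have dP := linear_differentiable t cP.
have dPE v : 'd (mulmxr P) t v = v *m P by rewrite diff_lin.
have dPh := differentiable_pair dP dh.
split; first exact: (differentiable_comp dPh dg).
(* The transposes are compared on basis row vectors, where products with Jacobians become
   differentials. *)
apply: trmx_inj; apply/row_matrixP => i; rewrite !rowE Dparam_mul; last first.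
  exact: (differentiable_comp dPh dg).
rewrite (diff_comp dPh dg) /= diff_pair //= dg12 dPE /=.
rewrite linearD /= -Dparam_mul // -Jinput_mul // -Dparam_mul //.
by rewrite linearD /= mulmxDr !trmx_mul (trmxK P) !mulmxA.
Qed.

(** * Coordinate blocks of the parameter vector *)

(** Distinct blocks share no index, since a rank determines its block. *)
Lemma submxrow1_orthogonal (R : pzRingType) L (p : 'I_L -> nat) (k l : 'I_L) :
  k != l ->
  (submxrow (1%:M : 'M[R]_(\sum_i p i)) k)^T *m submxrow 1%:M l = 0.
Proof.
move=> kl; rewrite mul_submxrow mulmx1; apply/matrixP => i j; rewrite !mxE.
by rewrite -val_eqE tagnat.eq_Rank eq_sym (negbTE kl).
Qed.

Lemma submxrow1_orthonormal (R : pzRingType) L (p : 'I_L -> nat) (l : 'I_L) :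
  (submxrow (1%:M : 'M[R]_(\sum_i p i)) l)^T *m submxrow 1%:M l = 1%:M.
Proof.
rewrite mul_submxrow mulmx1; apply/matrixP => i j; rewrite !mxE.
by rewrite -val_eqE tagnat.eq_Rank eqxx [in RHS]eq_sym.
Qed.

(** * Induction on the number of layers *)

Section LayerInduction.
Variables (R : realType) (L N : nat) (p : 'I_L -> nat) (d : nat -> nat).
Variable f :
  forall l : 'I_L, 'rV[R]_(p l) -> 'M[R]_(d l, N) -> 'M[R]_(d l.+1, N).
Arguments f : clear implicits.
Variable X : 'M[R]_(d 0%N, N).
Hypothesis df : forall (l : 'I_L) x,
  differentiable (fun x : 'rV[R]_(p l) * 'M[R]_(d l, N) => f l x.1 x.2) x.
Variable theta : 'rV[R]_(\sum_(l < L) p l).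

Let F n (n_le_L : (n <= L)%N) t := compose_first f X t n_le_L.

Let DF n (n_le_L : (n <= L)%N) := Dparam (F n_le_L) theta.

(** Right multiplication by this block extracts the parameter of layer [l]; its transpose is the
    selector [S_l]. *)
Let coord (l : 'I_L) : 'M[R]_(\sum_(l < L) p l, p l) := submxrow 1%:M l.

Let Df (l : 'I_L) :=
  Dparam (fun t => f l t (f_below f X theta l)) (param theta l).

Let Jf (l : 'I_L) := Jinput (f l (param theta l)) (f_below f X theta l).

Lemma compose_first_chain n (n_lt_L : (n < L)%N) :
  differentiable (F (ltnW n_lt_L)) theta ->
  differentiable (F n_lt_L) theta /\
  DF n_lt_L = Df (Ordinal n_lt_L) *m (coord (Ordinal n_lt_L))^T +
              Jf (Ordinal n_lt_L) *m DF (ltnW n_lt_L).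
Proof.
have paramE t : param t (Ordinal n_lt_L) = t *m coord (Ordinal n_lt_L).
  by rewrite mul_submxrow mulmx1.
have FS : F n_lt_L =
    fun t => f (Ordinal n_lt_L) (t *m coord (Ordinal n_lt_L))
      (F (ltnW n_lt_L) t).
  by apply: funext => t; rewrite -paramE.
move=> dF; rewrite /DF FS /Df /Jf paramE /f_below.
(* [f_below] carries its own proof of the index bound, identified here with the one at hand. *)
rewrite (bool_irrelevance (ltnW (ltn_ord (Ordinal n_lt_L))) (ltnW n_lt_L)).
exact: (@Dparam_chain _ _ _ _ _ _ (f (Ordinal n_lt_L)) _ _ _ (df _) dF).
Qed.

Lemma compose_first_differentiable n (n_le_L : (n <= L)%N) :
  differentiable (F n_le_L) theta.
Proof.
elim: n n_le_L => [|n IHn] n_le_L; first exact: differentiable_cst.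
by have [] := compose_first_chain (IHn (ltnW n_le_L)).
Qed.

(** The first [n] layers read only parameters of index below [n]. This gives the orthogonality that
    [lambda_layer] requires. *)
Lemma Dcompose_first_later_coord n (n_le_L : (n <= L)%N) (j : 'I_L) :
  (n <= j)%N -> DF n_le_L *m coord j = 0.
Proof.
elim: n n_le_L => [|n IHn] n_le_L n_le_j.
  apply: trmx_inj; apply/row_matrixP => i.
  rewrite trmx_mul trmx0 row_mul Dparam_mul; last exact: differentiable_cst.
  by rewrite diff_cst linear0 row0.
have [_ ->] := compose_first_chain (compose_first_differentiable (ltnW n_le_L)).
rewrite mulmxDl -!mulmxA IHn 1?ltnW // mulmx0 addr0.
rewrite submxrow1_orthogonal ?mulmx0 //.
by rewrite -val_eqE /= ltn_eqF.
Qed.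

(** Stopping at layer [n] permits a Horner-like induction: a new layer [k] multiplies the earlier
    sum by [lambda (Jf k)] and adds [lambda (Df k)]. *)
Lemma lambda_compose_first n (n_le_L : (n <= L)%N) :
  \sum_(l < L | (l < n)%N)
     lambda (Df l) * \prod_(j < L | (l < j < n)%N) lambda (Jf j)
  <= lambda (DF n_le_L).
Proof.
elim: n n_le_L => [|n IHn] n_lt_L.
  by rewrite big_pred0_eq lambda_ge0.
set k := Ordinal n_lt_L.
have [_ ->] := compose_first_chain (compose_first_differentiable (ltnW n_lt_L)).
apply: le_trans (lambda_layer _ _ _ _); rewrite ?trmxK; last 2 first.
- exact: submxrow1_orthonormal.
- exact: Dcompose_first_later_coord.
(* For [l = k] the product is empty: no [j] satisfies [n < j < n.+1]. *)
rewrite (bigD1 k) //= big_pred0 => [|j]; last first.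
  by rewrite ltnS; case: ltnP => //= /ltn_geF ->.
rewrite mulr1 lerD2l.
apply: le_trans (ler_wpM2l (lambda_ge0 _) (IHn (ltnW n_lt_L))).
rewrite mulr_sumr le_eqVlt; apply/orP; left; apply/eqP.
apply: eq_big => [l|l /andP[l_lt_n1 l_neq_k]].
  by rewrite -val_eqE /= ltnS [RHS]ltn_neqAle andbC.
have l_lt_n : (l < n)%N by rewrite ltn_neqAle l_neq_k -ltnS.
(* Each older product gains exactly the factor [j = k]. *)
rewrite (bigD1 k) /=; last by rewrite l_lt_n ltnSn.
rewrite mulrCA; congr (_ * (_ * _)); apply: eq_bigl => j.
by rewrite -val_eqE /= ltnS (ltn_neqAle j n) -andbA [X in _ && X]andbC.
Qed.

End LayerInduction.

Theorem proposition4p6 (R : realType) (L N : nat) (p : 'I_L -> nat)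
    (d : nat -> nat)
    (f : forall l : 'I_L, 'rV[R]_(p l) -> 'M[R]_(d l, N) -> 'M[R]_(d l.+1, N))
    (X : 'M[R]_(d 0%N, N)) :
  (forall l : 'I_L,
     continuously_differentiable
       (fun x : 'rV[R]_(p l) * 'M[R]_(d l, N) => f l x.1 x.2)) ->
  forall theta : 'rV[R]_(\sum_(l < L) p l),
    lambda (Dparam (param_fun f X) theta) >=
    \sum_(l < L)
      lambda (Dparam (fun t => f l t (f_below f X theta l)) (param theta l)) *
      \prod_(j < L | (l < j)%N)
        lambda (Jinput (f j (param theta j)) (f_below f X theta j)).
Proof.
move=> cdf theta.
apply: le_trans (lambda_compose_first X (fun l => (cdf l).1) theta (leqnn L)).
rewrite le_eqVlt; apply/orP; left; apply/eqP.
(* At [n = L] the cut-offs hold for every layer index. *)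
apply: eq_big => [l|l _]; first by rewrite ltn_ord.
by congr (_ * _); apply: eq_bigl => j; rewrite ltn_ord andbT.
Qed.
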